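(* If $r$ is a closed term with $r:A$ for some type $A$, and $r$ is in normal form with respect to $\rightsquigarrow$ (there is no $s$ with $r\rightsquigarrow s$), then $r$ is an introduction (an abstraction or a product).
   Context: Types are generated by $A ::= \tau \mid A\Rightarrow A \mid A\wedge A$, where $\tau$ is the only atomic type ($\Rightarrow$ associates to the right). Type equivalence $\equiv$ is the smallest congruence on types such that $A\wedge B\equiv B\wedge A$, $A\wedge(B\wedge C)\equiv(A\wedge B)\wedge C$, $A\Rightarrow(B\wedge C)\equiv(A\Rightarrow B)\wedge(A\Rightarrow C)$ and $(A\wedge B)\Rightarrow C\equiv A\Rightarrow B\Rightarrow C$. To each type $A$ is associated an infinite set of variables $\mathcal V_A$, with $\mathcal V_A=\mathcal V_B$ if $A\equiv B$ and $\mathcal V_A\cap\mathcal V_B=\emptyset$ otherwise. Preterms are $r ::= x \mid \lambda x.r \mid rr \mid r\times r \mid \pi_A(r)$ (application left associative); one writes $\lambda x^A.r$ for $\lambda x.r$ when $x\in\mathcal V_A$. Introductions are abstractions and products; eliminations are applications and projections. Substitution $r[s/x]$ is as usual; a term is closed if it has no free variables. Typing $r:A$ (without contexts): $x:A$ if $x\in\mathcal V_A$; if $r:A$ and $A\equiv B$ then $r:B$; if $r:B$ then $\lambda x^A.r:A\Rightarrow B$; if $r:A\Rightarrow B$ and $s:A$ then $rs:B$; if $r:A$ and $s:B$ then $r\times s:A\wedge B$; if $r:A\wedge B$ then $\pi_A(r):A$. Terms are well-typed preterms. $\rightleftarrows$ is the smallest symmetric relation, closed under all term contexts, containing $r\times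 s\rightleftarrows s\times r$, $(r\times s)\times t\rightleftarrows r\times(s\times t)$, $\lambda x^A.(r\times s)\rightleftarrows \lambda x^A.r\times\lambda x^A.s$, $rst\rightleftarrows r(s\times t)$; $\rightleftarrows^*$ is its reflexive transitive closure. Reduction: $\to_{\beta\pi\zeta}$: if $s:A$ then $(\lambda x^A.r)s\to_{\beta\pi\zeta} r[s/x]$; if $r:A$ then $\pi_A(r\times s)\to_{\beta\pi\zeta} r$; $(r\times s)t\to_{\beta\pi\zeta} rt\times st$. $\to_{\eta\delta}$: if $r:A\Rightarrow B$, $r$ is an elimination or a variable, and $x\in\mathcal V_A$ fresh, then $r\to_{\eta\delta}\lambda x^A.(rx)$; if $r:A\wedge B$ and $r$ is an elimination or a variable, then $r\to_{\eta\delta}\pi_A(r)\times\pi_B(r)$. The relations $\hookrightarrow$ and $\to$ are the smallest relations such that: $r\to_{\beta\pi\zeta}s$ implies $r\hookrightarrow s$; $r\to_{\eta\delta}s$ implies $r\to s$; $r\hookrightarrow s$ implies $r\to s$; $r\to s$ implies $\lambda x.r\hookrightarrow\lambda x.s$; $r\hookrightarrow s$ implies $rt\hookrightarrow st$; $r\to s$ implies $tr\hookrightarrow ts$, $r\times t\hookrightarrow s\times t$, $t\times r\hookrightarrow t\times s$; $r\hookrightarrow s$ implies $\pi_A(r)\hookrightarrow\pi_A(s)$. Finally $r\rightsquigarrow s$ iff $r\rightleftarrows^* r'\to s'\rightleftarrows^* s$ for some $r',s'$. *)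

(* Defs.v *)
From HB Require Import structures.
From mathcomp Require Import all_boot.
From mathcomp Require Import boolp.
From Stdlib Require Import Relation_Operators.

Set Implicit Arguments.
Unset Strict Implicit.
Unset Printing Implicit Defensive.

Inductive ty : Type :=
| Tau
| Arr of ty & ty
| And of ty & ty.

HB.instance Definition _ := gen_eqMixin ty.
HB.instance Definition _ := gen_choiceMixin ty.

Inductive teq : ty -> ty -> Prop :=
| teq_refl A : teq A A
| teq_sym A B : teq A B -> teq B A
| teq_trans A B C : teq A B -> teq B C -> teq A C
| teq_Arr A A' B B' : teq A A' -> teq B B' -> teq (Arr A B) (Arr A' B')
| teq_And A A' B B' : teq A A' -> teq B B' -> teq (And A B) (And A' B')
| teq_comm A B : teq (And A B) (And B A)
| teq_assoc A B C : teq (And A (And B C)) (And (And A B) C)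
| teq_distr A B C : teq (Arr A (And B C)) (And (Arr A B) (Arr A C))
| teq_curry A B C : teq (Arr (And A B) C) (Arr A (Arr B C)).

Definition teqb (A B : ty) : bool := `[< teq A B >].

Lemma teqb_refl : reflexive teqb.
Proof. by move=> A; apply/asboolP; exact: teq_refl. Qed.

Lemma teqb_sym : symmetric teqb.
Proof. by move=> A B; apply/asboolP/asboolP; exact: teq_sym. Qed.

Lemma teqb_trans : transitive teqb.
Proof.
by move=> B A C /asboolP AB /asboolP BC; apply/asboolP; exact: teq_trans AB BC.
Qed.

Canonical teqb_equiv := EquivRel teqb teqb_refl teqb_sym teqb_trans.

Local Open Scope quotient_scope.

Definition tyclass : Type := {eq_quot teqb}.

Definition cls (A : ty) : tyclass := \pi_({eq_quot teqb}) A.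

Lemma clsP A B : cls A = cls B <-> teq A B.
Proof.
split=> [/eqP|AB]; first by rewrite eqmodE => /asboolP.
by apply/eqP; rewrite eqmodE; apply/asboolP.
Qed.

(* The n-th variable attached to a class of types modulo equivalence. *)
Definition var : Type := (tyclass * nat)%type.

Definition V (A : ty) : pred var := [pred x | x.1 == cls A].

Lemma V_infinite A (s : seq var) : exists2 x, x \in V A & x \notin s.
Proof.
exists (cls A, (\max_(y <- s) y.2).+1); first by rewrite inE.
apply/negP=> xs; have := @leq_bigmax_seq _ s xpredT (fun y => y.2) _ xs isT.
by rewrite ltnn.
Qed.

Lemma V_teq A B : teq A B -> V A = V B.
Proof. by move=> /clsP AB; rewrite /V AB. Qed.

Lemma V_disjoint A B (x : var) : x \in V A -> x \in V B -> teq A B.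
Proof. by rewrite !inE => /eqP -> /eqP /clsP. Qed.

(* Preterms up to alpha-equivalence, in locally nameless form: [Var] is a free
   variable, while [BVar] is a de Bruijn index (0 being the innermost binder).
   The parameter [n] bounds the dangling indices. A binder only remembers the
   class of types of its variable, since that is what renaming preserves. *)
Inductive tm (n : nat) : Type :=
| BVar of 'I_n
| Var of var
| Lam of tyclass & tm n.+1
| App of tm n & tm n
| Prod of tm n & tm n
| Proj of ty & tm n.

Arguments BVar {n} _.
Arguments Var {n} _.
Arguments Lam {n} _ _.
Arguments App {n} _ _.
Arguments Prod {n} _ _.
Arguments Proj {n} _ _.

Definition preterm : Type := tm 0.

(* The abstracted variable gets bound outside all the binders already counted
   by [n], hence receives the largest index. *)
Fixpoint close (x : var) n (r : tm n) : tm n.+1 :=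
  match r with
  | BVar i => BVar (widen_ord (leqnSn n) i)
  | Var y => if y == x then BVar ord_max else Var y
  | Lam c r => Lam c (close x r)
  | App r s => App (close x r) (close x s)
  | Prod r s => Prod (close x r) (close x s)
  | Proj A r => Proj A (close x r)
  end.

(* [Abs x r] is the abstraction of [r] over the named variable [x]; [Lam] is
   its nameless representation. *)
Definition Abs (x : var) (r : preterm) : preterm := Lam x.1 (close x r).

Fixpoint widen n m (le_nm : n <= m) (r : tm n) : tm m :=
  match r with
  | BVar i => BVar (widen_ord le_nm i)
  | Var y => Var y
  | Lam c r => Lam c (@widen n.+1 m.+1 le_nm r)
  | App r s => App (widen le_nm r) (widen le_nm s)
  | Prod r s => Prod (widen le_nm r) (widen le_nm s)
  | Proj A r => Proj A (widen le_nm r)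
  end.

(* Free variables are names and bound ones are indices, so that no capture can
   occur; [s] has no dangling index, hence needs no shifting. *)
Fixpoint subst (s : preterm) (x : var) n (r : tm n) : tm n :=
  match r with
  | BVar i => BVar i
  | Var y => if y == x then widen (leq0n n) s else Var y
  | Lam c r => Lam c (subst s x r)
  | App r t => App (subst s x r) (subst s x t)
  | Prod r t => Prod (subst s x r) (subst s x t)
  | Proj A r => Proj A (subst s x r)
  end.

Fixpoint fv n (r : tm n) : seq var :=
  match r with
  | BVar _ => [::]
  | Var y => [:: y]
  | Lam _ r => fv r
  | App r s => fv r ++ fv s
  | Prod r s => fv r ++ fv s
  | Proj _ r => fv r
  end.

Definition closed_tm (r : preterm) : Prop := forall x, x \notin fv r.

Definition introduction (r : preterm) : Prop :=
  match r with Lam _ _ | Prod _ _ => True | _ => False end.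

Definition elimination (r : preterm) : Prop :=
  match r with App _ _ | Proj _ _ => True | _ => False end.

Definition variable (r : preterm) : Prop :=
  match r with Var _ => True | _ => False end.

Lemma close_surj (x : var) n (u : tm n.+1) :
  x \notin fv u -> exists v : tm n, close x v = u.
Proof.
pose P m : tm m -> Prop := match m with
  | 0 => fun=> True
  | m'.+1 => fun u => x \notin fv u -> exists v : tm m', close x v = u
  end.
suff: P n.+1 u by [].
elim: u => {n} [] [//|n] /= => [i|y|c r IH|r IHr s IHs|r IHr s IHs|B r IH];
  rewrite ?mem_cat ?negb_or.
- move=> _; case: (unliftP ord_max i) => [j ->|->].
    exists (BVar j) => /=; congr BVar; apply: val_inj => /=.
    by rewrite /bump leqNgt ltn_ord.
  by exists (Var x); rewrite /= eqxx.
- by rewrite andbT eq_sym => /negbTE yx; exists (Var y); rewrite /= yx.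
- by move=> /IH [v <-]; exists (Lam c v).
- by move=> /andP[/IHr [v <-] /IHs [w <-]]; exists (App v w).
- by move=> /andP[/IHr [v <-] /IHs [w <-]]; exists (Prod v w).
- by move=> /IH [v <-]; exists (Proj B v).
Qed.

Lemma fv_Abs (x : var) (r : preterm) : fv (Abs x r) = [seq y <- fv r | y != x].
Proof.
rewrite /Abs /=; elim: r => //= [n y|n r IHr s IHs|n r IHr s IHs].
- by case: eqVneq.
- by rewrite filter_cat IHr IHs.
- by rewrite filter_cat IHr IHs.
Qed.

Lemma introductionP (r : preterm) :
  introduction r <->
  (exists x s, r = Abs x s) \/ (exists s t, r = Prod s t).
Proof.
split; last by move=> [[x [s ->]]|[s [t ->]]].
case: r => //= [c b _|s t _]; last by right; exists s, t.
left; elim/quotW: c => A.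
have [x xA /close_surj[v <-]] := V_infinite A (fv b).
by exists x, v; rewrite /Abs; move: xA; rewrite inE => /eqP ->.
Qed.

Inductive typed : preterm -> ty -> Prop :=
| typed_Var x A : x \in V A -> typed (Var x) A
| typed_teq r A B : typed r A -> teq A B -> typed r B
| typed_Abs x r A B : x \in V A -> typed r B -> typed (Abs x r) (Arr A B)
| typed_App r s A B : typed r (Arr A B) -> typed s A -> typed (App r s) B
| typed_Prod r s A B : typed r A -> typed s B -> typed (Prod r s) (And A B)
| typed_Proj r A B : typed r (And A B) -> typed (Proj A r) A.

Inductive equi : preterm -> preterm -> Prop :=
| equi_sym r s : equi r s -> equi s r
| equi_comm r s : equi (Prod r s) (Prod s r)
| equi_assoc r s t : equi (Prod (Prod r s) t) (Prod r (Prod s t))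
| equi_distr x r s : equi (Abs x (Prod r s)) (Prod (Abs x r) (Abs x s))
| equi_curry r s t : equi (App (App r s) t) (App r (Prod s t))
| equi_Abs x r s : equi r s -> equi (Abs x r) (Abs x s)
| equi_Appl r s t : equi r s -> equi (App r t) (App s t)
| equi_Appr r s t : equi r s -> equi (App t r) (App t s)
| equi_Prodl r s t : equi r s -> equi (Prod r t) (Prod s t)
| equi_Prodr r s t : equi r s -> equi (Prod t r) (Prod t s)
| equi_Proj A r s : equi r s -> equi (Proj A r) (Proj A s).

Definition equis : preterm -> preterm -> Prop := clos_refl_trans preterm equi.

Inductive red_bpz : preterm -> preterm -> Prop :=
| red_beta x A r s : x \in V A -> typed s A ->
    red_bpz (App (Abs x r) s) (subst s x r)
| red_pi A r s : typed r A -> red_bpz (Proj A (Prod r s)) r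
| red_zeta r s t : red_bpz (App (Prod r s) t) (Prod (App r t) (App s t)).

Inductive red_ed : preterm -> preterm -> Prop :=
| red_eta x A B r : typed r (Arr A B) -> elimination r \/ variable r ->
    x \in V A -> x \notin fv r -> red_ed r (Abs x (App r (Var x)))
| red_delta A B r : typed r (And A B) -> elimination r \/ variable r ->
    red_ed r (Prod (Proj A r) (Proj B r)).

(* [hred] is the hooked arrow, which never eta/delta-expands the head. *)
Inductive hred : preterm -> preterm -> Prop :=
| hred_bpz r s : red_bpz r s -> hred r s
| hred_Abs x r s : red r s -> hred (Abs x r) (Abs x s)
| hred_Appl r s t : hred r s -> hred (App r t) (App s t)
| hred_Appr r s t : red r s -> hred (App t r) (App t s)
| hred_Prodl r s t : red r s -> hred (Prod r t) (Prod s t)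
| hred_Prodr r s t : red r s -> hred (Prod t r) (Prod t s)
| hred_Proj A r s : hred r s -> hred (Proj A r) (Proj A s)
with red : preterm -> preterm -> Prop :=
| red_red_ed r s : red_ed r s -> red r s
| red_hred r s : hred r s -> red r s.

Definition redm (r s : preterm) : Prop :=
  exists r' s', [/\ equis r r', red r' s' & equis s' s].

Definition normal_form (r : preterm) : Prop := ~ exists s, redm r s.

(* Main.v *)
From mathcomp Require Import all_boot.
From Stdlib Require Import Relation_Operators.
Require Import Defs.

(** Reading types as propositions with [Tau] false, type equivalence preserves
    truth and closed terms only inhabit true types. Hence a closed term has an
    arrow or conjunction type, and if it were an elimination it would
    eta- or delta-expand at the root. *)

Fixpoint ty_holds (A : ty) : Prop :=
  match A with
  | Tau => False
  | Arr A B => ty_holds A -> ty_holds B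
  | And A B => ty_holds A /\ ty_holds B
  end.

Lemma teq_ty_holds A B : teq A B -> ty_holds A <-> ty_holds B.
Proof. by elim=> {A B} /=; tauto. Qed.

(** The induction passes under binders, so open terms must be covered: truth of all types of the
    free variables stands in for a typing context. *)
Lemma typed_ty_holds r A : typed r A ->
  (forall x B, x \in fv r -> x \in V B -> ty_holds B) -> ty_holds A.
Proof.
elim=> {r A} [x A xA|r A B _ IH AB|x r A B xA _ IH|r s A B _ IHr _ IHs
  |r s A B _ IHr _ IHs|r A B _ IH] fvP /=.
- by apply: fvP xA; rewrite inE.
- exact: (proj1 (teq_ty_holds _ _ AB) (IH fvP)).
- move=> hA; apply: IH => y C yr yC; have [yx|yx] := eqVneq y x.
    (* If [y] is the bound [x], then [C] is equivalent to [A], which holds by [hA]. *)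
    by apply/(teq_ty_holds A C) => //; apply: V_disjoint xA _; rewrite -yx.
  by apply: fvP yC; rewrite fv_Abs mem_filter yx.
- by apply: IHr => [x C xr|]; [|apply: IHs => x C xs]; apply: fvP;
    rewrite mem_cat ?xr ?xs ?orbT.
- by split; [apply: IHr => x C xr|apply: IHs => x C xs]; apply: fvP;
    rewrite mem_cat ?xr ?xs ?orbT.
- by case: (IH fvP).
Qed.

Lemma closed_not_Tau r : closed_tm r -> ~ typed r Tau.
Proof.
by move=> r_closed /typed_ty_holds; apply=> x B xr; case/negP: (r_closed x).
Qed.

Lemma red_not_normal r s : red r s -> ~ normal_form r.
Proof. by move=> rs; apply; exists s, r, s; split=> //; exact: rt_refl. Qed.

(** At the root, [red] expands an elimination by eta at an arrow type and by delta at a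
    conjunction. *)
Lemma elimination_not_normal r A :
  typed r A -> A <> Tau -> elimination r -> ~ normal_form r.
Proof.
case: A => [//|A B|A B] rA _ r_elim.
- have [x xA xr] := V_infinite A (fv r).
  by apply/red_not_normal/red_red_ed/(red_eta rA _ xA xr); left.
- by apply/red_not_normal/red_red_ed/(red_delta rA); left.
Qed.

Theorem mainTheorem4 (r : preterm) (A : ty) :
  typed r A -> closed_tm r -> normal_form r -> introduction r.
Proof.
move=> rA r_closed r_nf.
have A_neq : A <> Tau by move=> eA; rewrite eA in rA; exact: closed_not_Tau rA.
have := elimination_not_normal _ _ rA A_neq.
(* [BVar] is impossible since ['I_0] is empty, and [Var x] since [x] would be free. *)
case: r rA r_closed r_nf => //= [[]//|x _ /(_ x)|r s _ _ nf|B r _ _ nf].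
- by rewrite inE eqxx.
- by move=> /(_ I nf).
- by move=> /(_ I nf).
Qed.
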